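(* Let $\mathcal{I}$ be a proper admissible ideal on $\mathbb{N}$ and let $\kappa$ be a cardinal. If $\kappa < \mathfrak{b}(\mathcal{I})$, then every countable subspace of $2^\kappa$ is $\mathcal{I}$-H-separable.
   Context: An ideal on $\mathbb{N}$ is a family of subsets of $\mathbb{N}$ closed under finite unions and under subsets; it is admissible if it contains every singleton and proper if it does not contain $\mathbb{N}$. $2^\kappa$ is the Cantor cube, i.e. the product of $\kappa$ copies of the discrete space $2=\{0,1\}$. A space $X$ is $\mathcal{I}$-H-separable if for every sequence $(Y_n)_{n\in\mathbb{N}}$ of dense subspaces of $X$ there is a sequence $(F_n)_{n\in\mathbb{N}}$ such that each $F_n$ is a finite subset of $Y_n$ and for every nonempty open set $U$ of $X$, $\{n\in\mathbb{N} : U\cap F_n=\emptyset\}\in\mathcal{I}$. A set $S\subseteq\mathbb{N}^{\mathbb{N}}$ is $\mathcal{I}$-bounded if there is $g\in\mathbb{N}^{\mathbb{N}}$ such that $\{n\in\mathbb{N}: f(n)>g(n)\}\in\mathcal{I}$ for all $f\in S$, and $\mathcal{I}$-unbounded otherwise; $\mathfrak{b}(\mathcal{I})$ is the least cardinality of an $\mathcal{I}$-unbounded subset of $\mathbb{N}^{\mathbb{N}}$. *)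

(* Defs.v *)
From mathcomp Require Import all_boot all_order.
From mathcomp Require Import all_classical all_analysis.

Set Implicit Arguments.
Unset Strict Implicit.
Unset Printing Implicit Defensive.

Local Open Scope classical_set_scope.
Local Open Scope card_scope.

Definition is_ideal (I : set (set nat)) : Prop :=
  [/\ I set0,
      forall A B, I A -> I B -> I (A `|` B) &
      forall A B, A `<=` B -> I B -> I A].

Definition admissible (I : set (set nat)) : Prop := forall n, I [set n].

Definition proper_ideal (I : set (set nat)) : Prop := ~ I [set: nat].

Definition ideal_H_separable (I : set (set nat)) (X : topologicalType) : Prop :=
  forall Y : nat -> set X, (forall n, dense (Y n)) ->
  exists F : nat -> set X,
    (forall n, finite_set (F n) /\ F n `<=` Y n) /\
    (forall U : set X, open U -> U !=set0 -> I [set n | U `&` F n = set0]).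

Definition ideal_bounded (I : set (set nat)) (S : set (nat -> nat)) : Prop :=
  exists g : nat -> nat, forall f, S f -> I [set n | (g n < f n)%N].

Definition ideal_unbounded (I : set (set nat)) (S : set (nat -> nat)) : Prop :=
  ~ ideal_bounded I S.

Definition card_lt (T U : Type) (A : set T) (B : set U) : Prop :=
  A #<= B /\ ~ (B #<= A).

Definition least_unbounded (I : set (set nat)) (S : set (nat -> nat)) : Prop :=
  ideal_unbounded I S /\ forall S', ideal_unbounded I S' -> S #<= S'.

(* There is no type of cardinal numbers in the library: the cardinal b(I) is
   represented by a chosen unbounded set of least cardinality. It is to be used
   only through [card_le], [card_eq] and [card_lt], so the choice is immaterial;
   [bnumberP] shows that such a set exists (otherwise it would be [setT]). *)
Definition bnumber (I : set (set nat)) : set (nat -> nat) :=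
  xget [set: nat -> nat] (least_unbounded I).

Lemma exists_least_card (T : Type) (P : set (set T)) :
  P !=set0 -> exists2 A, P A & forall B, P B -> A #<= B.
Proof.
move=> [A0 PA0].
pose Q : set (set (set T -> T)) := [set X |
  (forall x A, X x -> P A -> A (x A)) /\
  (forall x y A, X x -> X y -> P A -> x A = y A -> x = y)].
have [|X [[XP Xinj] Xmax]] := @Zorn_bigcup _ Q.
  move=> F FQ Ftot; split=> [x A [Z FZ Zx] PA|x y A [Z FZ Zx] [W FW Wy] PA xy].
    exact: (FQ _ FZ).1 PA.
  have [ZW|WZ] := Ftot _ _ FZ FW.
    by apply: (FQ _ FW).2 PA xy => //; exact: ZW.
  by apply: (FQ _ FZ).2 PA xy => //; exact: WZ.
have [[A PA Asurj]|nsurj] :=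
    pselect (exists2 A, P A & A `<=` (fun x => x A) @` X).
  exists A => // B PB.
  apply: (card_le_trans (subset_card_le Asurj)).
  apply: (card_le_trans (card_image_le _ _)).
  have XB : X #= (fun x : set T -> T => x B) @` X.
    apply: card_esym; apply: inj_card_eq => x y /set_mem Xx /set_mem Xy.
    exact: Xinj.
  rewrite (card_le_eql XB).
  by apply: subset_card_le => _ [x Xx <-]; exact: (XP x B Xx PB).
have step A : P A -> exists t, A t /\ forall x, X x -> x A <> t.
  move=> PA; apply: contrapT => /forallNP h; apply: nsurj; exists A => // t At.
  apply: contrapT => ht; apply: (h t); split=> // x Xx xt; apply: ht.
  by exists x.
have [t0 _] := step _ PA0.
have /choice[y yP] A : exists t, P A -> A t /\ forall x, X x -> x A <> t.
  have [/step[t ht]|nPA] := pselect (P A); first by exists t.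
  by exists t0.
exfalso; apply: (Xmax (X `|` [set y])).
  split; first exact: subsetUl.
  by move=> /(_ y (or_intror erefl)) Xy; have [_ /(_ _ Xy)] := yP _ PA0.
split=> [x A [Xx|->] PA|x z A [Xx|->] [Xz|->] PA xz //].
- exact: (XP x A Xx PA).
- by have [] := yP _ PA.
- exact: Xinj PA xz.
- by have [_ /(_ _ Xx)] := yP _ PA.
- by have [_ h] := yP _ PA; case: (h _ Xz).
Qed.

Lemma bnumberP (I : set (set nat)) : proper_ideal I ->
  least_unbounded I (bnumber I).
Proof.
move=> properI; apply: xgetPex.
have [|A ? ?] := @exists_least_card _ (ideal_unbounded I); last by exists A.
exists setT => -[g gP]; apply: properI.
have -> // : [set: nat] = [set n | (g n < (g n).+1)%N].
  by apply/seteqP; split=> n //= _.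
exact: (gP (fun n => (g n).+1)).
Qed.

(* Main.v *)
Require Import Defs.
From mathcomp Require Import all_boot all_order.
From mathcomp Require Import all_classical all_analysis.

Local Open Scope classical_set_scope.

(** The subspace A of 2^K has a base indexed by the finite partial functions
    from K to 2, here the words s over K * bool. Fix an injection e of A into
    nat and dense sets Y_n. For every word s whose cylinder meets A, let f_s(n)
    be the code of a point of Y_n in that cylinder. If one g bounds all the f_s
    modulo I, the finite sets F_n = {y in Y_n : e y <= g n} are as required:
    where f_s(n) <= g n, the chosen point of Y_n lies both in F_n and in the
    cylinder of s.

    It remains to bound a family indexed by words. Call an index set small if
    every family of functions that it indexes is I-bounded. A small union of
    small sets is small: bound each piece, then bound the bounds
    ([small_bigcup]). As nat is small because I is admissible ([small_nat]) and
    K is small by hypothesis ([small_lt]), the words of each length are small by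
    induction on the length, and so is the set of all words ([small_seq]). *)

(** * Index sets of bounded families *)

(** This is [|D| < b(I)], stated through the families that [D] indexes so that
    images and unions can be treated without comparing cardinals. *)
Definition small (I : set (set nat)) {T : Type} (D : set T) : Prop :=
  forall f : T -> nat -> nat, ideal_bounded I (f @` D).

Lemma small_lt (I : set (set nat)) (T : Type) (D : set T) :
  proper_ideal I -> card_lt D (bnumber I) -> small I D.
Proof.
move=> /bnumberP[_ bmin] [_ nbD] f; apply: contrapT => unb.
by apply: nbD; apply: card_le_trans (bmin _ unb) (card_image_le _ _).
Qed.

Lemma small_image (I : set (set nat)) (T U : Type) (h : T -> U) (D : set T) :
  small I D -> small I (h @` D).
Proof.
by move=> sD f; have [g gP] := sD (f \o h); exists g => _ [_ [x Dx <-] <-];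
  apply: gP; exists x.
Qed.

(** This is the regularity of b(I): the bounds of the pieces form a family
    indexed by [J], and a bound of these bounds is a bound of everything,
    because the exceptional sets add up to the union of two members of [I]. *)
Lemma small_bigcup (I : set (set nat)) (S T : Type) (J : set S)
    (D : S -> set T) :
  is_ideal I -> small I J -> (forall j, small I (D j)) ->
  small I (\bigcup_(j in J) D j).
Proof.
move=> [_ IU IS] sJ sD f.
have /choice[h hP] j : exists g : nat -> nat,
    forall x, D j x -> I [set n | (g n < f x n)%N].
  by have [g gP] := sD j f; exists g => x Dx; apply: gP; exists x.
have [g gP] := sJ h.
exists g => _ [x [j Jj Dx] <-].
have Igh : I [set n | (g n < h j n)%N] by apply: gP; exists j.
apply: (IS _ _ _ (IU _ _ Igh (hP j x Dx))) => n /= gf.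
by case: (ltnP (g n) (h j n)) => [|hg]; [left|right; exact: leq_ltn_trans gf].
Qed.

Lemma ideal_initial_segment (I : set (set nat)) (m : nat) :
  is_ideal I -> admissible I -> I [set n | (n < m)%N].
Proof.
move=> [I0 IU IS] admI; elim: m => [|m IHm]; first exact: IS I0.
apply: IS (IU _ _ IHm (admI m)) => n /=.
by rewrite ltnS leq_eqVlt => /orP[/eqP|]; [right|left].
Qed.

(** The diagonal argument: [g n], the maximum of [f 0 n], ..., [f n n], is at
    least [f m n] as soon as [n >= m]. *)
Lemma small_nat (I : set (set nat)) :
  is_ideal I -> admissible I -> small I [set: nat].
Proof.
move=> idI admI f; have [_ _ IS] := idI.
exists (fun n => \max_(i < n.+1) f i n) => _ [m _ <-].
apply: IS (ideal_initial_segment I m idI admI) => n /=.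
apply: contraTT; rewrite -!leqNgt -ltnS => mn.
exact: (leq_bigmax (F := fun i : 'I_n.+1 => f i n) (Ordinal mn)).
Qed.

Lemma small_prod_bool (I : set (set nat)) (K : Type) :
  is_ideal I -> admissible I -> small I [set: K] -> small I [set: K * bool].
Proof.
move=> idI admI sK.
have sb : small I [set: bool].
  have -> : [set: bool] = odd @` [set: nat].
    by apply/seteqP; split=> // b _; exists b => //; case: b.
  exact/small_image/small_nat.
have -> : [set: K * bool] = \bigcup_(b in [set: bool]) (pair^~ b @` [set: K]).
  by apply/seteqP; split=> // -[k b] _; exists b => //; exists k.
by apply: small_bigcup => // b; exact: small_image.
Qed.

Lemma small_seq (I : set (set nat)) (T : Type) :
  is_ideal I -> admissible I -> small I [set: T] -> small I [set: seq T].
Proof.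
move=> idI admI sT.
have -> : [set: seq T] = \bigcup_(n in [set: nat]) [set s : seq T | size s = n].
  by apply/seteqP; split=> // s _; exists (size s).
apply: small_bigcup => //; first exact: small_nat.
elim=> [|n IHn].
  have -> : [set s : seq T | size s = 0] = (fun=> [::]) @` [set: nat].
    apply/seteqP; split=> [s /size0nil ->|_ [_ _ <-] //].
    by exists 0.
  exact/small_image/small_nat.
have -> : [set s : seq T | size s = n.+1] =
    \bigcup_(x in [set: T]) (cons x @` [set s : seq T | size s = n]).
  apply/seteqP; split=> [[|x s] // [sn]|_ [x _ [s <- <-]] //].
  by exists x => //; exists s.
by apply: small_bigcup => // x; exact: small_image.
Qed.

(** * The standard base of the Cantor cube *)

Definition cylinder {K : Type} (s : seq (K * bool)) :
    set (prod_topology (fun _ : K => bool)) :=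
  [set x | all (fun p => x p.1 == p.2) s].

Lemma cylinder_cat (K : Type) (s t : seq (K * bool)) :
  cylinder (s ++ t) = cylinder s `&` cylinder t.
Proof.
apply/seteqP; split=> x; rewrite /cylinder /= all_cat; first by move/andP.
by case=> -> ->.
Qed.

Lemma open_cylinder (K : Type) (s : seq (K * bool)) : open (cylinder s).
Proof.
elim: s => [|[k b] s IHs].
  by have -> : @cylinder K [::] = setT; [exact/seteqP|exact: openT].
rewrite -cat1s cylinder_cat; apply: openI => //.
have -> : cylinder [:: (k, b)] = @proj K (fun=> bool) k @^-1` [set b].
  by apply/seteqP; split=> x; rewrite /cylinder /= andbT => /eqP.
apply: open_comp; last exact: discrete_open.
(* Coordinate projections are continuous for index types with decidable
   equality, which [{classic K}] supplies for an arbitrary K. *)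
by move=> x _; exact: (@proj_continuous {classic K}).
Qed.

(** The cylinders around [x] generate a filter; it converges to [x] since it
    does so in every coordinate, hence it refines the neighbourhoods of [x]. *)
Lemma open_cylinder_base (K : Type)
    (V : set (prod_topology (fun _ : K => bool))) x :
  open V -> V x -> exists2 s, cylinder s x & cylinder s `<=` V.
Proof.
move=> oV Vx.
pose F : set_system (prod_topology (fun _ : K => bool)) :=
  filter_from [set s | cylinder s x] cylinder.
have FF : Filter F.
  apply: filter_from_filter; first by exists [::].
  move=> s t sx tx; exists (s ++ t); last by rewrite cylinder_cat.
  by change (cylinder (s ++ t) x); rewrite cylinder_cat.
suff : F --> x by move/(_ V (open_nbhs_nbhs (conj oV Vx))).
apply/cvg_sup => k B; rewrite nbhsE => -[_ [[C oC <-] Cx] CB].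
exists [:: (k, x k)]; first by rewrite /cylinder /= eqxx.
by move=> y; rewrite /cylinder /= andbT => /eqP yk; apply: CB; rewrite /= /proj yk.
Qed.

(** * Selecting the finite sets *)

(** Density of the [Y n] makes every cylinder that meets [A] contain a point of
    [Y n], and a bound on the codes [e] of such points, taken over all words,
    determines the finite sets. *)
Theorem small_ideal_H_separable (I : set (set nat)) (K : Type) :
  is_ideal I -> small I [set: seq (K * bool)] ->
  forall A : set (prod_topology (fun _ : K => bool)),
    countable A -> ideal_H_separable I A.
Proof.
move=> [_ _ IS] sK A /countable_injP[e einj] Y dY.
pose code (y : A) := e (\val y).
have code_inj : injective code.
  by move=> y z yz; apply/val_inj/einj => //; exact/mem_set/set_valP.
have /choice[f fP] (p : seq (K * bool) * nat) : exists m,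
    (exists y : A, cylinder p.1 (\val y)) ->
    exists y : A, [/\ Y p.2 y, cylinder p.1 (\val y) & code y = m].
  case: p => s n /=.
  have [sA|nsA] := pselect (exists y : A, cylinder s (\val y)); last by exists 0.
  have [|y [sy Yy]] := dY n (\val @^-1` cylinder s) sA.
    by exists (cylinder s) => //; exact: open_cylinder.
  by exists (code y) => _; exists y.
have [g gP] := sK (fun s n => f (s, n)).
exists (fun n => Y n `&` [set y | (code y <= g n)%N]); split=> [n|U].
  split; last by move=> y [].
  apply: (@sub_finite_set _ _ (code @^-1` `I_(g n).+1)); first by move=> y [].
  by apply: finite_preimage => [y z _ _|]; [exact: code_inj|exact: finite_II].
move=> [V oV <-] [x Vx].
have [s sx sV] := open_cylinder_base K V (\val x) oV Vx.
apply: IS (gP (fun n => f (s, n)) _); last by exists s.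
move=> n /= UF; rewrite ltnNge; apply/negP => fg.
have [|y [Yy sy yf]] := fP (s, n); first by exists x.
suff : set0 y by [].
by rewrite -UF; split; [exact: sV|split=> //=; rewrite yf].
Qed.

(* The cardinal kappa is that of the type K. A subset A coerces to its subtype,
   which carries the subspace topology. *)
Theorem corollary3p19 (I : set (set nat)) (K : Type) :
  is_ideal I -> admissible I -> proper_ideal I ->
  card_lt [set: K] (bnumber I) ->
  forall A : set (prod_topology (fun _ : K => bool)),
    countable A -> ideal_H_separable I A.
Proof.
move=> idI admI propI ltK; apply: small_ideal_H_separable => //.
exact/small_seq/small_prod_bool/small_lt.
Qed.
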